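(* Let $R$ be a commutative ring and let $S$ be the antipode of the Hopf algebra $\mathtt{NCQSym}$ over $R$. Then for every $n\geq2$ we have $$S(\mathrm{F}_{n}^{w^{0}_{n}})=(-1)^{n}\mathrm{F}_{1^{n}}^{\operatorname{Id}_{n}}$$ and $$S(\mathrm{F}_{1^{n}}^{w^{0}_{n}})=S(\mathrm{M}_{1^{n}}^{w^{0}_{n}})=(-1)^{n}\mathrm{F}_{n}^{\operatorname{Id}_{n}}=(-1)^{n}\mathrm{E}_{1^{n}}^{\operatorname{Id}_{n}},$$ where the subscript $n$ denotes the composition $(n)$ of length $1$ and $1^{n}$ denotes the composition $(1,\ldots,1)$ of $n$ of length $n$.
   Context: Compositions. A composition $\alpha\vDash n$ of an integer $n\geq0$ is a finite sequence $(\alpha_{1},\ldots,\alpha_{\ell})$ of positive integers summing to $n$; $\ell(\alpha)=\ell$. For compositions $\alpha,\beta$ of the same $n$, $\beta\preceq\alpha$ (equivalently $\alpha\succeq\beta$) means that $\beta$ refines $\alpha$, i.e., $\beta$ is the concatenation, in order, of compositions of $\alpha_{1},\ldots,\alpha_{\ell}$. Put $\mathbb{N}_{n}=\{1,\ldots,n\}$. The Hopf algebra $\mathtt{NCQSym}$ (word quasi-symmetric functions). A set composition $\mathbf{A}=(A_{1},\ldots,A_{\ell})\vDash\mathbb{N}_{n}$ is an ordered collection of non-empty pairwise disjoint sets with union $\mathbb{N}_{n}$. In the ring of power series over $R$ in non-commuting variables $x_{1},x_{2},\ldots$, for $\mathbf{A}\vDash\mathbb{N}_{n}$ of length $\ell$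 and $I=\{i_{1}<\cdots<i_{\ell}\}\subseteq\mathbb{N}$, let $x_{I}^{\mathbf{A}}=x_{\eta_{1}}x_{\eta_{2}}\cdots x_{\eta_{n}}$, where $\eta_{k}=i_{j}$ if $k\in A_{j}$, and set $\mathrm{M}_{\mathbf{A}}=\sum_{|I|=\ell}x_{I}^{\mathbf{A}}$ (with $\mathrm{M}_{\emptyset}=1$). $\mathtt{NCQSym}$ is the free $R$-module with basis $\{\mathrm{M}_{\mathbf{A}}\}$, $\mathbf{A}$ running over set compositions of $\mathbb{N}_{n}$ for all $n\geq0$, graded by $n$; it is closed under the product of power series. Its co-multiplication is $\Delta(\mathrm{M}_{\mathbf{A}})=\sum_{k=0}^{\ell}\mathrm{M}_{\operatorname{st}(A_{1},\ldots,A_{k})}\otimes\mathrm{M}_{\operatorname{st}(A_{k+1},\ldots,A_{\ell})}$, where $\operatorname{st}$ transports a set composition of a finite $X\subseteq\mathbb{N}$ to one of $\mathbb{N}_{|X|}$ via the order-preserving bijection $X\to\mathbb{N}_{|X|}$; the co-unit is the projection onto degree $0$. This is a connected graded bi-algebra, hence a Hopf algebra, whose antipode is the two-sided convolution inverse of the identity. For $\alpha\vDash n$ and $\rho\in S_{n}$, $\mathbf{A}_{\alpha}^{\rho}\vDash\mathbb{N}_{n}$ is the set composition whose $j$th set is $\{\rho(k)\;|\;\alpha_{1}+\cdots+\alpha_{j-1}<k\leq\alpha_{1}+\cdots+\alpha_{j}\}$. Set $\mathrm{M}_{\alpha}^{\rho}=\mathrm{M}_{\mathbf{A}_{\alpha}^{\rho}}$,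 $\mathrm{F}_{\alpha}^{\rho}=\sum_{\beta\preceq\alpha}\mathrm{M}_{\beta}^{\rho}$, and $\mathrm{E}_{\alpha}^{\rho}=\sum_{\beta\succeq\alpha}\mathrm{M}_{\beta}^{\rho}$. $\operatorname{Id}_{n}\in S_{n}$ is the identity and $w^{0}_{n}\in S_{n}$ is the longest element, $w^{0}_{n}(i)=n+1-i$. *)

(* Defs.v *)
From HB Require Import structures.
From mathcomp Require Import all_boot all_order all_algebra all_fingroup.
From mathcomp Require Import finmap monalg.

Set Implicit Arguments.
Unset Strict Implicit.
Unset Printing Implicit Defensive.

Import GRing.Theory.

Local Open Scope ring_scope.

(* Words over [nat] stand for monomials; the letter [i] is the variable
   x_(i+1).  Positions in a word, and elements of set compositions, are
   numbered from 1. *)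

Section SetCompositions.
Local Open Scope fset_scope.
Local Open Scope nat_scope.

Definition ground (s : seq {fset nat}) : {fset nat} := \bigcup_(B <- s) B.

Definition is_osp (s : seq {fset nat}) : bool :=
  all (fun B : {fset nat} => B != fset0) s
  && pairwise (fun B C : {fset nat} => [disjoint B & C]) s.

Definition NN (n : nat) : {fset nat} := [fset k in iota 1 n].

Definition is_setcomp (s : seq {fset nat}) : bool :=
  is_osp s && (ground s == NN #|` ground s|).

Record setcomp := SetComp { blocks :> seq {fset nat}; setcompP : is_setcomp blocks }.

HB.instance Definition _ := [isSub for blocks].
HB.instance Definition _ := [Choice of setcomp by <:].

Definition sdegree (A : setcomp) : nat := #|` ground A|.

Lemma in_ground s k : (k \in ground s) = has (fun B : {fset nat} => k \in B) s.
Proof.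
rewrite /ground; elim: s => [|B s IH]; first by rewrite big_nil inE.
by rewrite big_cons inE IH.
Qed.

Lemma in_NN n k : (k \in NN n) = (0 < k <= n).
Proof. by rewrite !inE mem_iota add1n ltnS. Qed.

Lemma card_NN n : #|` NN n| = n.
Proof. by rewrite card_fseq undup_id ?iota_uniq // size_iota. Qed.

Lemma ground_setcomp (A : setcomp) : ground A = NN (sdegree A).
Proof. by have /andP[_ /eqP] := setcompP A. Qed.

Lemma is_setcompP s n : is_osp s -> ground s = NN n -> is_setcomp s.
Proof. by move=> osp_s gs; rewrite /is_setcomp osp_s gs card_NN eqxx. Qed.

Definition relabel (f : nat -> nat) (s : seq {fset nat}) : seq {fset nat} :=
  [seq [fset f x | x in (B : {fset nat})] | B : {fset nat} <- s].

Lemma ground_relabel f s : ground (relabel f s) = [fset f x | x in ground s].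
Proof.
apply/fsetP=> k; rewrite in_ground has_map.
apply/hasP/imfsetP=> /= [[B Bs /imfsetP[x xB ->]]|[x]].
  by exists x => //; rewrite in_ground; apply/hasP; exists B.
rewrite in_ground => /hasP[B Bs xB] ->; exists B => //.
by apply/imfsetP; exists x.
Qed.

Lemma relabel_osp f s :
  {in ground s &, injective f} -> is_osp s -> is_osp (relabel f s).
Proof.
move=> f_inj /andP[s_n0 s_dj]; apply/andP; split.
  rewrite all_map; apply: sub_all s_n0 => B /= /fset0Pn[x xB].
  by apply/fset0Pn; exists (f x); apply/imfsetP; exists x.
have sub B x : B \in s -> x \in (B : {fset nat}) -> x \in ground s.
  by move=> Bs xB; rewrite in_ground; apply/hasP; exists B.
rewrite pairwise_map.
apply: (@sub_in_pairwise _ [in s]) s_dj; last by apply/allP.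
move=> B C Bs Cs /= /fdisjointP dj; apply/fdisjointP => _ /imfsetP[x /= xB ->].
apply/negP=> /imfsetP[y /= yC fxy]; have := dj x xB.
by rewrite (f_inj _ _ (sub _ _ Bs xB) (sub _ _ Cs yC) fxy) yC.
Qed.

(* The order preserving bijection from [X] to [NN #|` X|]. *)
Definition rank (X : {fset nat}) (x : nat) : nat := #|` [fset y in X | y <= x]|.

Lemma rank_lt X x y : x \in X -> y \in X -> (rank X x < rank X y) = (x < y).
Proof.
have aux a b : b \in X -> a < b -> rank X a < rank X b.
  move=> bX ab; apply: fproper_ltn_card; apply/andP; split.
    apply/fsubsetP=> z; rewrite !inE => /andP[-> za] /=.
    exact: leq_trans za (ltnW ab).
  by apply/fsubsetPn; exists b; rewrite !inE bX /= ?leqnn // -ltnNge.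
move=> xX yX; case: (ltngtP x y) => [xy|yx|->]; [exact: aux| |exact: ltnn].
by apply/negbTE; rewrite -leqNgt ltnW // aux.
Qed.

Lemma rank_inj X : {in X &, injective (rank X)}.
Proof.
move=> x y xX yX rxy; have := rank_lt xX yX; have := rank_lt yX xX.
by rewrite rxy ltnn; case: ltngtP.
Qed.

Lemma rank_img X : [fset rank X x | x in X] = NN #|` X|.
Proof.
apply/eqP; rewrite eqEfcard card_NN card_in_imfset /=; last exact: rank_inj.
rewrite leqnn andbT; apply/fsubsetP => _ /imfsetP[x /= xX ->].
rewrite in_NN cardfs_gt0; apply/andP; split.
  by apply/fset0Pn; exists x; rewrite !inE xX leqnn.
by apply: fsubset_leq_card; apply/fsubsetP=> y; rewrite !inE => /andP[].
Qed.

Definition st (s : seq {fset nat}) : seq {fset nat} :=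
  relabel (rank (ground s)) s.

Lemma st_setcomp s : is_osp s -> is_setcomp (st s).
Proof.
move=> osp_s; apply: (@is_setcompP _ #|` ground s|).
  by apply: relabel_osp => //; apply: rank_inj.
by rewrite ground_relabel rank_img.
Qed.

Lemma osp_cat s1 s2 : is_osp (s1 ++ s2) -> is_osp s1 * is_osp s2.
Proof.
rewrite /is_osp all_cat pairwise_cat => /andP[/andP[-> ->]].
by case/and3P=> _ -> ->.
Qed.

Lemma osp_take (A : setcomp) k : is_osp (take k A).
Proof.
have /andP[+ _] := setcompP A.
by rewrite -{1}(cat_take_drop k A) => /osp_cat ->.
Qed.

Lemma osp_drop (A : setcomp) k : is_osp (drop k A).
Proof.
have /andP[+ _] := setcompP A.
by rewrite -{1}(cat_take_drop k A) => /osp_cat ->.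
Qed.

Definition st_take (k : nat) (A : setcomp) : setcomp :=
  SetComp (st_setcomp (osp_take A k)).
Definition st_drop (k : nat) (A : setcomp) : setcomp :=
  SetComp (st_setcomp (osp_drop A k)).

Lemma nil_setcomp : is_setcomp [::].
Proof.
apply: (@is_setcompP _ 0) => //; apply/fsetP=> k.
by rewrite in_ground in_NN; case: k.
Qed.

Definition setcomp0 : setcomp := SetComp nil_setcomp.


(* [xword A I] is the word of the monomial x_I^A. *)
Definition bindex (s : seq {fset nat}) (k : nat) : nat :=
  find (fun B : {fset nat} => k \in B) s.

Definition xword (A : setcomp) (I : seq nat) : seq nat :=
  [seq nth 0 I (bindex A k) | k <- iota 1 (sdegree A)].

Definition letters (w : seq nat) : seq nat := sort leq (undup w).

(* The coefficient (0 or 1) of the word [w] in M_A: by [in_MP] and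
   [letters_xword], it is the number of sets I with |I| = l(A) and
   x_I^A = w. *)
Definition in_M (A : setcomp) (w : seq nat) : bool :=
  (size (letters w) == size A) && (w == xword A (letters w)).

Lemma mem_letters w : letters w =i w.
Proof. by move=> k; rewrite mem_sort mem_undup. Qed.

Lemma letters_sorted w : sorted ltn (letters w).
Proof.
rewrite ltn_sorted_uniq_leq sort_uniq undup_uniq.
exact: (sort_sorted leq_total).
Qed.

Lemma letters_eq w I : sorted ltn I -> I =i w -> letters w = I.
Proof.
move=> sI Iw; apply: (irr_sorted_eq ltn_trans ltnn) => //.
  exact: letters_sorted.
by move=> k; rewrite mem_letters Iw.
Qed.

Lemma bindexP (A : setcomp) k :
  0 < k <= sdegree A ->
  bindex A k < size A /\ k \in nth fset0 A (bindex A k).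
Proof.
rewrite -in_NN -ground_setcomp in_ground => kA.
by split; [rewrite -has_find | exact: (nth_find fset0 kA)].
Qed.

Lemma bindex_nth s j k :
  is_osp s -> j < size s -> k \in nth fset0 s j -> bindex s k = j.
Proof.
case/andP=> _ /(pairwiseP fset0) dj js kj.
have ks : has (fun B : {fset nat} => k \in B) s.
  by apply/hasP; exists (nth fset0 s j) => //; apply: mem_nth.
have := nth_find fset0 ks; rewrite -/(bindex s k); move: ks.
rewrite has_find -/(bindex s k) => bs kb.
case: (ltngtP (bindex s k) j) => // lt_.
  by have /fdisjointP/(_ k kb) := dj _ _ bs js lt_; rewrite kj.
by have /fdisjointP/(_ k kj) := dj _ _ js bs lt_; rewrite kb.
Qed.

Lemma setcomp_osp (A : setcomp) : is_osp A.
Proof. by case/andP: (setcompP A). Qed.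

Lemma bindex_onto (A : setcomp) j :
  j < size A -> exists2 k, 0 < k <= sdegree A & bindex A k = j.
Proof.
move=> jA; have /andP[/allP An0 _] := setcomp_osp A.
have /fset0Pn[k kj] := An0 _ (mem_nth fset0 jA); exists k.
  rewrite -in_NN -ground_setcomp in_ground; apply/hasP.
  by exists (nth fset0 A j) => //; apply: mem_nth.
exact: bindex_nth (setcomp_osp A) jA kj.
Qed.

Lemma size_xword A I : size (xword A I) = sdegree A.
Proof. by rewrite size_map size_iota. Qed.

Lemma nth_xword A I i :
  i < sdegree A -> nth 0 (xword A I) i = nth 0 I (bindex A i.+1).
Proof.
by move=> iA; rewrite (nth_map 0) ?size_iota // nth_iota // add1n.
Qed.

Lemma mem_xword (A : setcomp) I : size I = size A -> xword A I =i I.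
Proof.
move=> sI x; apply/mapP/idP => [[k]|xI].
  rewrite mem_iota add1n ltnS => /bindexP[kA _] ->.
  by apply: mem_nth; rewrite sI.
have jA : index x I < size A by rewrite -sI index_mem.
have [k kA kj] := bindex_onto jA.
by exists k; rewrite ?mem_iota ?add1n ?ltnS // kj nth_index.
Qed.

Lemma letters_xword (A : setcomp) I :
  sorted ltn I -> size I = size A -> letters (xword A I) = I.
Proof.
by move=> sI szI; apply: letters_eq => // k; rewrite mem_xword.
Qed.

Lemma in_MP (A : setcomp) w :
  reflect (exists I, [/\ sorted ltn I, size I = size A & w = xword A I])
          (in_M A w).
Proof.
apply: (iffP andP) => [[/eqP sz /eqP ->]|[I [sI szI ->]]].
  exists (letters w); split=> //; exact: letters_sorted.
by rewrite letters_xword // szI !eqxx.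
Qed.

(* The only set composition [A] such that [w] occurs in M_A. *)
Definition pack_seq (w : seq nat) : seq {fset nat} :=
  [seq [fset k in iota 1 (size w) | nth 0 w k.-1 == i] | i <- letters w].

Lemma in_pack_block w i k :
  (k \in [fset k in iota 1 (size w) | nth 0 w k.-1 == i])
    = (0 < k <= size w) && (nth 0 w k.-1 == i).
Proof. by rewrite !inE mem_iota add1n ltnS. Qed.

Lemma ground_pack w : ground (pack_seq w) = NN (size w).
Proof.
apply/fsetP=> k; rewrite in_ground in_NN has_map; apply/hasP/idP.
  by case=> i _ /=; rewrite in_pack_block => /andP[].
move=> kw; exists (nth 0 w k.-1); last by rewrite /= in_pack_block kw eqxx.
by rewrite mem_letters mem_nth //; case: k kw.
Qed.

Lemma pack_proof w : is_setcomp (pack_seq w).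
Proof.
apply: is_setcompP (ground_pack w); apply/andP; split.
  apply/allP=> B /mapP[i]; rewrite mem_letters => iw ->.
  apply/fset0Pn; exists (index i w).+1.
  by rewrite in_pack_block /= index_mem iw nth_index ?eqxx.
rewrite pairwise_map.
have := letters_sorted w; rewrite (sorted_pairwise ltn_trans).
apply: sub_pairwise => i j ij; apply/fdisjointP => k.
rewrite !in_pack_block => /andP[-> /eqP -> /=].
by rewrite neq_ltn ij.
Qed.

Definition pack (w : seq nat) : setcomp := SetComp (pack_proof w).

Lemma sdegree_pack w : sdegree (pack w) = size w.
Proof. by rewrite /sdegree ground_pack card_NN. Qed.

Lemma size_pack w : size (pack w) = size (letters w).
Proof. by rewrite size_map. Qed.

Lemma bindex_pack w i :
  i < size w -> bindex (pack w) i.+1 = index (nth 0 w i) (letters w).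
Proof.
move=> iw; have mw : nth 0 w i \in letters w by rewrite mem_letters mem_nth.
have jw : index (nth 0 w i) (letters w) < size (letters w) by rewrite index_mem.
apply: bindex_nth (setcomp_osp _) _ _; first by rewrite size_pack.
by rewrite (nth_map 0) // nth_index // in_pack_block /= iw eqxx.
Qed.

Lemma in_ME A w : in_M A w = (A == pack w).
Proof.
apply/idP/eqP => [/andP[/eqP sz /eqP wE]|->]; last first.
  rewrite /in_M size_pack eqxx; apply/eqP; apply: (@eq_from_nth _ 0).
    by rewrite size_xword sdegree_pack.
  move=> i iw; rewrite nth_xword ?sdegree_pack // bindex_pack //.
  by rewrite nth_index // mem_letters mem_nth.
have szw : size w = sdegree A by rewrite wE size_xword.
apply: val_inj; apply: (@eq_from_nth _ fset0); first by rewrite /= size_map.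
move=> j jA; have jw : j < size (letters w) by rewrite sz.
rewrite /= (nth_map 0) //; apply/fsetP=> k; rewrite in_pack_block.
rewrite szw; case: (boolP (0 < k <= _)) => [kA|]; last first.
  rewrite -in_NN -ground_setcomp in_ground -all_predC => /allP kNA.
  exact/negbTE/kNA/mem_nth.
have [bA kb] := bindexP kA.
have -> : nth 0 w k.-1 = nth 0 (letters w) (bindex A k).
  by rewrite {1}wE nth_xword; case: k kA {bA kb}.
rewrite nth_uniq ?sz //; last first.
  exact: (sorted_uniq ltn_trans ltnn (letters_sorted w)).
apply/idP/eqP => [kj|<-//]; exact: bindex_nth (setcomp_osp A) jA kj.
Qed.

Definition canon (A : setcomp) : seq nat := xword A (iota 0 (size A)).

Lemma canonK A : pack (canon A) = A.
Proof.
apply/esym/eqP; rewrite -in_ME; apply/in_MP.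
by exists (iota 0 (size A)); rewrite iota_ltn_sorted size_iota.
Qed.

Lemma size_canon A : size (canon A) = sdegree A.
Proof. exact: size_xword. Qed.

Lemma pack_eqP w w' :
  pack w = pack w' <->
  size w = size w' /\
  forall i j, i < size w -> j < size w ->
    (nth 0 w i <= nth 0 w j) = (nth 0 w' i <= nth 0 w' j).
Proof.
split=> [pE|[sz le_eq]].
  have sz : size w = size w' by rewrite -!sdegree_pack pE.
  split=> // i j iw jw.
  have aux u a b : a < size u -> b < size u -> (nth 0 u a <= nth 0 u b) =
      (bindex (pack u) a.+1 <= bindex (pack u) b.+1).
    move=> au bu; rewrite !bindex_pack //.
    have mu c : c < size u -> nth 0 u c \in letters u.
      by move=> cu; rewrite mem_letters mem_nth.
    have nlt := sorted_ltn_nth ltn_trans 0 (letters_sorted u).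
    have lt_ c d : c < size u -> d < size u ->
        index (nth 0 u c) (letters u) < index (nth 0 u d) (letters u) ->
        nth 0 u c < nth 0 u d.
      move=> cu du /nlt; rewrite !inE !index_mem => /(_ (mu _ cu) (mu _ du)).
      by rewrite (nth_index 0 (mu _ cu)) (nth_index 0 (mu _ du)).
    case: (ltngtP (index (nth 0 u a) (letters u)) _) => [/lt_|/lt_|eq_].
    - by move=> /(_ au bu) /ltnW.
    - by move=> /(_ bu au); rewrite ltnNge => /negbTE.
    - by rewrite -[nth 0 u a](nth_index 0 (mu _ au)) eq_ nth_index ?leqnn ?mu.
  by rewrite (aux w) // (aux w') -?sz // pE.
have eq_eq i j : i < size w -> j < size w ->
    nth 0 w i = nth 0 w j -> nth 0 w' i = nth 0 w' j.
  move=> iw jw e; apply/eqP.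
  by rewrite eqn_leq -!le_eq // e leqnn.
have lt_eq i j : i < size w -> j < size w ->
    nth 0 w i < nth 0 w j -> nth 0 w' i < nth 0 w' j.
  by move=> iw jw; rewrite !ltnNge le_eq.
apply/eqP; rewrite -in_ME; apply/in_MP.
pose phi x := nth 0 w' (index x w).
exists [seq phi x | x <- letters w]; split.
- rewrite sorted_map.
  apply: (@sub_in_sorted _ [in w] ltn) (letters_sorted w); last first.
    by apply/allP=> x; rewrite mem_letters.
  move=> x y xw yw xy.
  by rewrite /= /phi lt_eq ?index_mem // !nth_index.
- by rewrite size_map size_pack.
apply: (@eq_from_nth _ 0); first by rewrite size_xword sdegree_pack.
move=> i; rewrite -sz => iw; rewrite nth_xword ?sdegree_pack //.
have mw : nth 0 w i \in letters w by rewrite mem_letters mem_nth.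
rewrite bindex_pack // (nth_map 0) ?index_mem // nth_index // /phi.
apply: eq_eq => //; first by rewrite index_mem -mem_letters.
by rewrite nth_index // -mem_letters.
Qed.

Lemma pack_take w w' i : pack w = pack w' -> pack (take i w) = pack (take i w').
Proof.
case/pack_eqP=> sz le_eq; apply/pack_eqP.
rewrite !size_take sz; split=> // a b alt blt.
have sub c : c < (if i < size w' then i else size w') -> (c < i) && (c < size w').
  by case: (ltnP i) => h ch; [rewrite ch (ltn_trans ch h)|rewrite (leq_trans ch h)].
have /andP[ai aw] := sub a alt; have /andP[bi bw] := sub b blt.
by rewrite !nth_take // le_eq ?sz.
Qed.

Lemma pack_drop w w' i : pack w = pack w' -> pack (drop i w) = pack (drop i w').
Proof.
case/pack_eqP=> sz le_eq; apply/pack_eqP.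
rewrite !size_drop sz; split=> // a b; rewrite -sz !ltn_subRL => alt blt.
by rewrite !nth_drop le_eq.
Qed.


Definition setcomps (n : nat) : seq setcomp :=
  undup [seq pack [seq val i | i <- val u] | u : n.-tuple 'I_n].

Lemma size_letters w : size (letters w) <= size w.
Proof. by rewrite size_sort size_undup. Qed.

Lemma mem_setcomps n (A : setcomp) : (A \in setcomps n) = (sdegree A == n).
Proof.
rewrite mem_undup; apply/imageP/eqP => [[u _ ->]|<-].
  by rewrite sdegree_pack size_map size_tuple.
have ltA x : x \in canon A -> x < sdegree A.
  rewrite mem_xword ?size_iota // mem_iota add0n => /leq_trans; apply.
  by rewrite -{1}(canonK A) size_pack -(size_canon A) size_letters.
have szA : size (pmap (@insub _ _ 'I_(sdegree A)) (canon A)) == sdegree A.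
  rewrite size_pmap_sub -[X in _ == X](size_canon A) -all_count.
  exact/allP.
exists (Tuple szA) => //=; rewrite -[LHS]canonK; congr pack.
rewrite -[LHS]filter_predT; apply/esym.
rewrite (pmap_filter (@insubK _ _ _)); apply: eq_in_filter => x xA.
by rewrite insubT //; exact: ltA.
Qed.

End SetCompositions.

Section Standardization.
Local Open Scope fset_scope.
Local Open Scope nat_scope.

Lemma relabel_comp f g h s :
  {in ground s, forall x, g (f x) = h x} -> relabel g (relabel f s) = relabel h s.
Proof.
move=> gf; rewrite /relabel -map_comp; apply/eq_in_map => B Bs /=.
have sB x : x \in B -> x \in ground s.
  by move=> xB; rewrite in_ground; apply/hasP; exists B.
apply/fsetP=> y; apply/imfsetP/imfsetP => /= [[_ /imfsetP[x /= xB ->] ->]|[x xB ->]].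
  by exists x; rewrite // gf // sB.
by exists (f x); [apply/imfsetP; exists x | rewrite gf // sB].
Qed.

Lemma st_relabel f s :
  {in ground s &, {mono f : x y / x <= y}} -> st (relabel f s) = st s.
Proof.
move=> fle; apply: relabel_comp => x xs; rewrite ground_relabel /rank.
have f_inj : {in ground s &, injective f}.
  move=> a b ai bi fab; apply/eqP.
  by rewrite eqn_leq -fle // -[b <= a]fle // fab leqnn.
set X := (X in _ = #|` X|).
have <- : #|` [fset f z | z in X]| = #|` X|.
  rewrite card_in_imfset //= => a b; rewrite !inE => /andP[ai _] /andP[bi _].
  exact: f_inj.
apply: (congr1 (fun Z : {fset nat} => #|` Z|)); apply/fsetP=> y; rewrite !inE.
apply/andP/imfsetP => /= [[/imfsetP[z /= zs ->]]|[z]].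
  by rewrite fle // => zx; exists z; rewrite // !inE zs.
rewrite !inE => /andP[zs zx] ->; rewrite fle // zx; split=> //.
by apply/imfsetP; exists z.
Qed.

Lemma rank_le X : {in X &, {mono rank X : x y / x <= y}}.
Proof. by move=> x y xX yX; rewrite leqNgt rank_lt // -leqNgt. Qed.

Lemma ground_sub s t : {subset t <= s} -> {subset ground t <= ground s}.
Proof.
move=> ts x; rewrite !in_ground => /hasP[B Bt xB].
by apply/hasP; exists B => //; apply: ts.
Qed.

Lemma st_sub s t : {subset t <= s} -> st (relabel (rank (ground s)) t) = st t.
Proof.
move=> ts; apply: st_relabel => x y xt yt.
by rewrite rank_le //; apply: ground_sub ts _ _.
Qed.

Lemma st_take_st_take j k (A : setcomp) : j <= k -> st_take j (st_take k A) = st_take j A.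
Proof.
move=> jk; apply: val_inj; rewrite /= /st -map_take.
by rewrite [LHS]st_sub => [|B /mem_take //]; rewrite take_takel.
Qed.

Lemma st_drop_st_take j k (A : setcomp) :
  j <= k -> st_drop j (st_take k A) = st_take (k - j) (st_drop j A).
Proof.
move=> jk; apply: val_inj; rewrite /= /st -map_drop -map_take.
rewrite [LHS]st_sub => [|B /mem_drop //]; rewrite [RHS]st_sub => [|B /mem_take //].
by rewrite take_drop subnK.
Qed.

Lemma st_drop_st_drop j k (A : setcomp) : st_drop j (st_drop k A) = st_drop (j + k) A.
Proof.
apply: val_inj; rewrite /= /st -map_drop.
by rewrite [LHS]st_sub => [|B /mem_drop //]; rewrite drop_drop.
Qed.

Lemma rank_NN n x : x \in NN n -> rank (NN n) x = x.
Proof.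
rewrite in_NN => /andP[x0 xn]; rewrite -[RHS]card_NN.
apply: (congr1 (fun Z : {fset nat} => #|` Z|)).
apply/fsetP=> y; rewrite in_NN inE /= -/(NN n) inE /= in_NN.
by case: (leqP y x) => [yx|]; rewrite ?andbF // andbT (leq_trans yx xn).
Qed.

Lemma st_setcompK (A : setcomp) : st A = A.
Proof.
rewrite /st /relabel -[RHS]map_id; apply/eq_in_map => B BA.
have sB x : x \in B -> rank (ground A) x = x.
  move=> xB; rewrite ground_setcomp rank_NN // -ground_setcomp in_ground.
  by apply/hasP; exists B.
apply/fsetP=> y; apply/imfsetP/idP => /= [[x xB ->]|yB]; first by rewrite sB.
by exists y; rewrite ?sB.
Qed.

Lemma st_drop0 (A : setcomp) : st_drop 0 A = A.
Proof. by apply: val_inj; rewrite /= drop0 st_setcompK. Qed.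

Lemma st_take_size (A : setcomp) : st_take (size A) A = A.
Proof. by apply: val_inj; rewrite /= take_size st_setcompK. Qed.

Lemma size_st_take k (A : setcomp) : k <= size A -> size (st_take k A) = k.
Proof. by move=> kA; rewrite /= size_map size_takel. Qed.

Lemma size_st_drop k (A : setcomp) : size (st_drop k A) = size A - k.
Proof. by rewrite /= size_map size_drop. Qed.

Lemma setcomp_size0 (A : setcomp) : (setcomp0 == A) = (size A == 0).
Proof.
apply/eqP/eqP => [<- //|/size0nil A0].
by apply: val_inj; rewrite /= A0.
Qed.
End Standardization.

(* {malg R[K]} with the scaling of the library, which asks for [R] to be
   nontrivial, replaced by one for all rings. *)
Definition freemod (R : pzRingType) (K : choiceType) : Type := {malg R[K]}.

Section FreeModule.
Variables (R : pzRingType) (K : choiceType).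

HB.instance Definition _ := GRing.Zmodule.on (freemod R K).

Definition fm_scale (c : R) (x : freemod R K) : freemod R K :=
  [malg k in msupp x => c * x@_k].

Lemma fm_scaleE c x k : (fm_scale c x)@_k = c * x@_k.
Proof. by rewrite mcoeffE; case: msuppP => // _; rewrite mulr0. Qed.

Lemma fm_scaleA c d x : fm_scale c (fm_scale d x) = fm_scale (c * d) x.
Proof. by apply/malgP=> k; rewrite !fm_scaleE mulrA. Qed.

Lemma fm_scale1 : left_id 1 fm_scale.
Proof. by move=> x; apply/malgP=> k; rewrite fm_scaleE mul1r. Qed.

Lemma fm_scaleDr : right_distributive fm_scale +%R.
Proof. by move=> c x y; apply/malgP=> k; rewrite mcoeffD !fm_scaleE mcoeffD mulrDr. Qed.

Lemma fm_scaleDl x : {morph fm_scale^~ x : c d / c + d}.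
Proof. by move=> c d; apply/malgP=> k; rewrite mcoeffD !fm_scaleE mulrDl. Qed.

HB.instance Definition _ := GRing.Zmodule_isLmodule.Build R (freemod R K)
  fm_scaleA fm_scale1 fm_scaleDr fm_scaleDl.

Definition fm_basis (k : K) : freemod R K := << k >>.

Lemma fm_coeffZ (c : R) (x : freemod R K) k : (c *: x)@_k = c * x@_k.
Proof. exact: fm_scaleE. Qed.

Lemma fm_coeff_basis k l : (fm_basis k)@_l = (k == l)%:R.
Proof. exact: mcoeffU. Qed.

Lemma fm_coeff_sum (I : Type) (r : seq I) (P : pred I) (F : I -> freemod R K) k :
  (\sum_(i <- r | P i) F i)@_k = \sum_(i <- r | P i) (F i)@_k.
Proof. exact: (big_morph _ (@mcoeffD K R k) (@mcoeff0 K R k)). Qed.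

Definition fm_lin (V : lmodType R) (f : K -> V) (x : freemod R K) : V :=
  \sum_(k <- msupp x) x@_k *: f k.

Section Lin.
Variables (V : lmodType R) (f : K -> V).

Lemma fm_linw (D : {fset K}) x :
  (msupp x `<=` D)%fset -> fm_lin f x = \sum_(k <- D) x@_k *: f k.
Proof.
move=> xD; apply: big_fset_incl => // k _ /mcoeff_outdom ->.
by rewrite scale0r.
Qed.

Lemma fm_lin_is_linear : linear (fm_lin f).
Proof.
move=> c x y; pose D := (msupp x `|` msupp y `|` msupp (c *: x + y))%fset.
rewrite !(@fm_linw D) ?fsubsetUr //; last first.
- by rewrite /D -fsetUA fsubsetUl.
- by rewrite /D fsetUAC fsubsetUr.
rewrite scaler_sumr -big_split /=; apply: eq_bigr => k _.
by rewrite mcoeffD fm_coeffZ scalerDl scalerA.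
Qed.

HB.instance Definition _ :=
  GRing.isLinear.Build R (freemod R K) V *:%R (fm_lin f) fm_lin_is_linear.

Lemma fm_lin_basis k : fm_lin f (fm_basis k) = f k.
Proof.
rewrite (@fm_linw [fset k]%fset) ?msuppU_le // big_seq_fset1.
by rewrite fm_coeff_basis eqxx scale1r.
Qed.
End Lin.

Lemma fm_expand (x : freemod R K) : x = fm_lin fm_basis x.
Proof.
apply/malgP=> l; rewrite /fm_lin {1}[x](@monalgE K R x) raddf_sum /= fm_coeff_sum.
apply: eq_bigr => k _.
by rewrite fm_coeffZ fm_coeff_basis mcoeffU mulr_natr.
Qed.
End FreeModule.

Definition NCQSym (R : comPzRingType) : Type := freemod R setcomp.
Definition NCQSym2 (R : comPzRingType) : Type := freemod R (setcomp * setcomp)%type.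

(* Power series in the non-commuting x_i: the coefficient of each word. *)
Definition ncseries (R : comPzRingType) : Type := seq nat -> R.

Section NCQSym.
Variable R : comPzRingType.

HB.instance Definition _ := GRing.Lmodule.on (NCQSym R).
HB.instance Definition _ := GRing.Lmodule.on (NCQSym2 R).

Definition M_set (A : setcomp) : NCQSym R := fm_basis R A.

Definition tens (x y : NCQSym R) : NCQSym2 R :=
  fm_lin (fun A => fm_lin (fun B => fm_basis R (A, B) : NCQSym2 R) y) x.

Definition series_mul (f g : ncseries R) : ncseries R :=
  fun w => \sum_(i < (size w).+1) f (take i w) * g (drop i w).

Definition M_series (A : setcomp) : ncseries R := fun w => (in_M A w)%:R.

Definition to_series (x : NCQSym R) : ncseries R :=
  fun w => \sum_(A <- msupp x) x@_A * M_series A w.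

(* The product of two quasi-symmetric series is quasi-symmetric, so the
   coefficient of M_C in it is its coefficient at any word of M_C. *)
Definition mulM (A B : setcomp) : NCQSym R :=
  \sum_(C <- setcomps (sdegree A + sdegree B))
     series_mul (M_series A) (M_series B) (canon C) *: M_set C.

Definition ncmul (x y : NCQSym R) : NCQSym R :=
  fm_lin (fun A => fm_lin (mulM A) y) x.

Lemma to_seriesE x w : to_series x w = x@_(pack w).
Proof.
rewrite /to_series [in RHS](fm_expand x) /fm_lin fm_coeff_sum; apply: eq_bigr => A _.
by rewrite fm_coeffZ fm_coeff_basis /M_series in_ME.
Qed.

Lemma to_series_inj x y : to_series x =1 to_series y -> x = y.
Proof.
move=> xy; apply/malgP=> A.
by rewrite -(canonK A) -!to_seriesE.
Qed.

Lemma to_seriesM x y :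
  to_series (ncmul x y) =1 series_mul (to_series x) (to_series y).
Proof.
move=> w; rewrite to_seriesE.
have mulM_E A B : (mulM A B)@_(pack w)
    = series_mul (M_series A) (M_series B) w.
  rewrite /mulM fm_coeff_sum.
  under eq_bigr => C _ do rewrite fm_coeffZ fm_coeff_basis.
  have [dw|dw] := boolP (pack w \in setcomps (sdegree A + sdegree B)).
    rewrite (bigD1_seq (pack w)) ?undup_uniq //= eqxx mulr1.
    rewrite big1 ?addr0 => [|C /negbTE ->]; last by rewrite mulr0.
    have pw : pack (canon (pack w)) = pack w by rewrite canonK.
    have sz : size (canon (pack w)) = size w by rewrite size_canon sdegree_pack.
    rewrite /series_mul sz; apply: eq_bigr => i _.
    by rewrite /M_series !in_ME (pack_take i pw) (pack_drop i pw).
  rewrite big_seq big1 => [|C Cin]; last first.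
    by case: eqP dw => [<-|]; rewrite ?Cin // mulr0.
  apply/esym/big1 => i _; rewrite /M_series !in_ME.
  case: eqP => [AE|_]; last by rewrite mul0r.
  case: eqP => [BE|_]; last by rewrite mulr0.
  case/negP: dw; rewrite mem_setcomps AE BE !sdegree_pack.
  by rewrite -size_cat cat_take_drop.
rewrite /ncmul /fm_lin fm_coeff_sum.
under eq_bigr => A _.
  rewrite fm_coeffZ fm_coeff_sum mulr_sumr.
  under eq_bigr => B _ do rewrite fm_coeffZ mulM_E /series_mul !mulr_sumr.
  over.
rewrite /series_mul; under [RHS]eq_bigr => i _ do
  [rewrite /to_series mulr_suml; under eq_bigr => A _ do rewrite mulr_sumr].
rewrite [RHS]exchange_big /=; apply: eq_bigr => A _.
rewrite [RHS]exchange_big /=; apply: eq_bigr => B _; apply: eq_bigr => i _.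
by rewrite mulrACA mulrA.
Qed.

Lemma ncmulE x y w :
  (ncmul x y)@_(pack w)
    = \sum_(i < (size w).+1) x@_(pack (take i w)) * y@_(pack (drop i w)).
Proof.
by rewrite -to_seriesE to_seriesM; apply: eq_bigr => i _; rewrite !to_seriesE.
Qed.

Lemma NCQSymP (x y : NCQSym R) : (forall w, x@_(pack w) = y@_(pack w)) -> x = y.
Proof. by move=> xy; apply/to_series_inj => w; rewrite !to_seriesE. Qed.

Lemma pack_eq0 w : (setcomp0 == pack w) = (w == [::]).
Proof.
apply/eqP/eqP => [/(congr1 sdegree)|->].
  rewrite sdegree_pack => /esym sz; apply/nilP; rewrite /nilp sz /sdegree.
  by rewrite cardfs_eq0; apply/eqP/fsetP=> k; rewrite in_ground.
by apply: val_inj.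
Qed.

Lemma ncmul1 : left_id (M_set setcomp0) ncmul.
Proof.
move=> x; apply: NCQSymP => w; rewrite ncmulE big_ord_recl take0 drop0.
rewrite fm_coeff_basis pack_eq0 mul1r big1 ?addr0 // => i _.
by rewrite fm_coeff_basis pack_eq0 lift0; case: w i => [[]|a w i] //=; rewrite mul0r.
Qed.

Lemma ncmulr1 : right_id (M_set setcomp0) ncmul.
Proof.
move=> x; apply: NCQSymP => w; rewrite ncmulE big_ord_recr /= take_size drop_size.
rewrite fm_coeff_basis pack_eq0 mulr1 big1 ?add0r // => i _.
rewrite fm_coeff_basis pack_eq0 -size_eq0 size_drop.
by rewrite subn_eq0 leqNgt ltn_ord mulr0.
Qed.

Lemma ncmulDl : left_distributive ncmul +%R.
Proof. by move=> x y z; rewrite /ncmul linearD. Qed.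

Lemma ncmulDr : right_distributive ncmul +%R.
Proof.
move=> x y z; apply: NCQSymP => w; rewrite mcoeffD !ncmulE -big_split /=.
by apply: eq_bigr => i _; rewrite mcoeffD mulrDr.
Qed.

Lemma ncmulA : associative ncmul.
Proof.
move=> x y z; apply: NCQSymP => w; rewrite !ncmulE.
pose F i j := x@_(pack (take i w)) * y@_(pack (take j (drop i w)))
                * z@_(pack (drop (i + j) w)).
transitivity (\sum_(i < (size w).+1) \sum_(j < (size w - i).+1) F i j).
  apply: eq_bigr => i _; rewrite ncmulE size_drop mulr_sumr.
  by apply: eq_bigr => j _; rewrite drop_drop addnC mulrA.
transitivity (\sum_(k < (size w).+1) \sum_(i < k.+1) F i (k - i)%N); last first.
  apply: eq_bigr => k _; rewrite ncmulE mulr_suml size_takel -1?ltnS //.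
  apply: eq_bigr => i _; have ik : (i <= k)%N by rewrite -ltnS.
  by rewrite /F subnKC // take_takel // take_drop subnK.
have H n : \sum_(i < n.+1) \sum_(j < (n - i).+1) F i j
         = \sum_(k < n.+1) \sum_(i < k.+1) F i (k - i)%N.
  elim: n => [|n IHn]; first by rewrite !big_ord1.
  rewrite [RHS]big_ord_recr -IHn big_ord_recr /= subnn big_ord1.
  rewrite [X in _ = _ + X]big_ord_recr /= subnn addrA -big_split /=.
  congr (_ + _); apply: eq_bigr => i _.
  by rewrite subSn -1?ltnS // big_ord_recr.
exact: H.
Qed.

HB.instance Definition _ := GRing.Zmodule_isPzRing.Build (NCQSym R)
  ncmulA ncmul1 ncmulr1 ncmulDl ncmulDr.

Lemma to_series_mul (x y : NCQSym R) :
  to_series (x * y) =1 series_mul (to_series x) (to_series y).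
Proof. exact: to_seriesM. Qed.

Lemma NCQSym_scalerAl (c : R) (x y : NCQSym R) : c *: (x * y) = (c *: x) * y.
Proof. by rewrite [LHS]/GRing.scale /=; rewrite /GRing.mul /= /ncmul linearZ. Qed.

Lemma NCQSym_scalerAr (c : R) (x y : NCQSym R) : c *: (x * y) = x * (c *: y).
Proof.
apply: NCQSymP => w; rewrite fm_coeffZ !ncmulE mulr_sumr.
by apply: eq_bigr => i _; rewrite fm_coeffZ mulrCA.
Qed.

Definition mul_map : NCQSym2 R -> NCQSym R :=
  fm_lin (fun p => M_set p.1 * M_set p.2).

Definition comul : NCQSym R -> NCQSym2 R :=
  fm_lin (fun A : setcomp =>
    \sum_(0 <= k < (size A).+1) tens (M_set (st_take k A)) (M_set (st_drop k A))).

(* The projection onto degree 0, which is spanned by 1 = M_setcomp0. *)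
Definition counit (x : NCQSym R) : R := x@_setcomp0.

Definition tens_map (f g : NCQSym R -> NCQSym R) : NCQSym2 R -> NCQSym2 R :=
  fm_lin (fun p => tens (f (M_set p.1)) (g (M_set p.2))).

HB.instance Definition _ := GRing.isLinear.Build R (NCQSym2 R) (NCQSym R) *:%R
  mul_map (fm_lin_is_linear _).
HB.instance Definition _ := GRing.isLinear.Build R (NCQSym R) (NCQSym2 R) *:%R
  comul (fm_lin_is_linear _).
HB.instance Definition _ f g :=
  GRing.isLinear.Build R (NCQSym2 R) (NCQSym2 R) *:%R
    (tens_map f g) (fm_lin_is_linear _).

Definition convolution (f g : NCQSym R -> NCQSym R) (x : NCQSym R) : NCQSym R :=
  mul_map (tens_map f g (comul x)).

Definition is_antipode (S : {linear NCQSym R -> NCQSym R}) : Prop :=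
  forall x : NCQSym R,
    convolution S idfun x = counit x *: (1 : NCQSym R)
    /\ convolution idfun S x = counit x *: (1 : NCQSym R).

End NCQSym.

Section Antipode.
Variable R : comPzRingType.
Implicit Types (A B : setcomp) (x y : NCQSym R).
Local Notation Mb := (M_set R).

Lemma tens_basis A B : tens (Mb A) (Mb B) = fm_basis R (A, B).
Proof. by rewrite /tens !fm_lin_basis. Qed.

Lemma tens_map_basis (f g : NCQSym R -> NCQSym R) A B :
  tens_map f g (fm_basis R (A, B)) = tens (f (Mb A)) (g (Mb B)).
Proof. exact: fm_lin_basis. Qed.

Lemma mul_map_tens x y : mul_map (tens x y) = x * y.
Proof.
rewrite /tens [x in RHS]fm_expand /fm_lin !linear_sum mulr_suml.
apply: eq_bigr => A _; rewrite linearZ -NCQSym_scalerAl; congr (_ *: _).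
rewrite [y in RHS]fm_expand /fm_lin linear_sum mulr_sumr.
apply: eq_bigr => B _; rewrite linearZ -NCQSym_scalerAr; congr (_ *: _).
exact: fm_lin_basis.
Qed.

Lemma convolution_M_set (f g : NCQSym R -> NCQSym R) A :
  convolution f g (Mb A) =
    \sum_(0 <= k < (size A).+1) f (Mb (st_take k A)) * g (Mb (st_drop k A)).
Proof.
rewrite /convolution /comul fm_lin_basis (linear_sum (tens_map f g)) (linear_sum (@mul_map R)).
apply: eq_bigr => k _.
by rewrite /= tens_basis tens_map_basis mul_map_tens.
Qed.

Lemma convolution_linear f g : linear (convolution f g : NCQSym R -> NCQSym R).
Proof. by move=> c x y; rewrite /convolution !linearP. Qed.

HB.instance Definition _ f g :=
  GRing.isLinear.Build R (NCQSym R) (NCQSym R) *:%R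
    (convolution f g) (convolution_linear f g).

Lemma NCQSym_lin_ext (f g : {linear NCQSym R -> NCQSym R}) :
  (forall A, f (Mb A) = g (Mb A)) -> f =1 g.
Proof.
move=> fg x; rewrite [x]fm_expand /fm_lin !linear_sum.
by apply: eq_bigr => A _; rewrite !linearZ -!/(Mb _) fg.
Qed.

Fixpoint Lrec n A : NCQSym R :=
  if n is n'.+1 then
    (size A == 0)%N%:R - \sum_(0 <= k < size A) Lrec n' (st_take k A) * Mb (st_drop k A)
  else 1.
Fixpoint Rrec n A : NCQSym R :=
  if n is n'.+1 then
    (size A == 0)%N%:R
      - \sum_(0 <= k < size A) Mb (st_take k.+1 A) * Rrec n' (st_drop k.+1 A)
  else 1.
Definition Lant A := Lrec (size A) A.
Definition Rant A := Rrec (size A) A.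

Lemma Lrec_fuel n A : (size A <= n)%N -> Lrec n A = Lant A.
Proof.
rewrite /Lant; move: {2}(size A) (leqnn (size A)) n => m.
elim: m A => [|m IH] A Am n.
  move: Am; rewrite leqn0 => /eqP A0; rewrite A0.
  by case: n => //= n _; rewrite A0 big_nil subr0.
case: n => [|n An]; first by rewrite leqn0 => /eqP ->.
case sA : (size A) => [|s] /=; first by rewrite sA big_nil subr0.
rewrite sA in Am An *; congr (_ - _); apply: eq_big_nat => k /andP[_ ks].
have szk : size (st_take k A) = k by apply: size_st_take; rewrite sA ltnW.
have ks' : (size (st_take k A) <= s)%N by rewrite szk -ltnS.
rewrite (IH _ (leq_trans ks' Am) n (leq_trans ks' An)).
by rewrite (IH _ (leq_trans ks' Am) s ks').
Qed.

Lemma Rrec_fuel n A : (size A <= n)%N -> Rrec n A = Rant A.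
Proof.
rewrite /Rant; move: {2}(size A) (leqnn (size A)) n => m.
elim: m A => [|m IH] A Am n.
  move: Am; rewrite leqn0 => /eqP A0; rewrite A0.
  by case: n => //= n _; rewrite A0 big_nil subr0.
case: n => [|n An]; first by rewrite leqn0 => /eqP ->.
case sA : (size A) => [|s] /=; first by rewrite sA big_nil subr0.
rewrite sA in Am An *; congr (_ - _); apply: eq_big_nat => k /andP[_ ks].
have szk : (size (st_drop k.+1 A) <= s)%N.
  by rewrite size_st_drop sA subSS leq_subr.
rewrite (IH _ (leq_trans szk Am) n (leq_trans szk An)).
by rewrite (IH _ (leq_trans szk Am) s szk).
Qed.

Lemma LantE A :
  \sum_(0 <= k < (size A).+1) Lant (st_take k A) * Mb (st_drop k A)
    = (size A == 0)%N%:R.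
Proof.
rewrite big_nat_recr //= st_take_size.
have -> : Mb (st_drop (size A) A) = 1.
  by congr M_set; apply/esym/eqP; rewrite setcomp_size0 size_st_drop subnn.
rewrite mulr1 {2}/Lant; case sA : (size A) => [|s] /=.
  by rewrite big_nil add0r.
rewrite sA sub0r; apply/eqP; rewrite subr_eq0; apply/eqP.
apply: eq_big_nat => k /andP[_ ks].
by rewrite Lrec_fuel // size_st_take ?sA // ltnW.
Qed.

Lemma RantE A :
  \sum_(0 <= k < (size A).+1) Mb (st_take k A) * Rant (st_drop k A)
    = (size A == 0)%N%:R.
Proof.
rewrite big_nat_recl //= st_drop0.
have -> : Mb (st_take 0 A) = 1.
  by congr M_set; apply/esym/eqP; rewrite setcomp_size0 size_st_take.
rewrite mul1r {1}/Rant; case sA : (size A) => [|s] /=.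
  by rewrite big_nil addr0.
rewrite sA sub0r addrC; apply/eqP; rewrite subr_eq0; apply/eqP.
apply: eq_big_nat => k /andP[_ ks].
by rewrite Rrec_fuel // size_st_drop sA subSS leq_subr.
Qed.

Lemma triangle n (G : nat -> nat -> NCQSym R) :
  \sum_(0 <= k < n) \sum_(0 <= j < k.+1) G j k
    = \sum_(0 <= j < n) \sum_(j <= k < n) G j k.
Proof.
elim: n => [|n IH]; first by rewrite !big_geq.
rewrite big_nat_recr //= IH [RHS]big_nat_recr //= big_nat1 big_nat_recr //= addrA.
rewrite -big_split; congr (_ + _); apply: eq_big_nat => j /andP[_ jn] /=.
by rewrite big_nat_recr // ltnW.
Qed.

Lemma convolution_inv_unique (L P : setcomp -> NCQSym R) :
  (forall A, \sum_(0 <= k < (size A).+1) L (st_take k A) * Mb (st_drop k A)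
               = (size A == 0)%N%:R) ->
  (forall A, \sum_(0 <= k < (size A).+1) Mb (st_take k A) * P (st_drop k A)
               = (size A == 0)%N%:R) ->
  L =1 P.
Proof.
move=> LE PE A; have T0 B : (size B = 0)%N -> B = setcomp0.
  by move=> B0; apply/esym/eqP; rewrite setcomp_size0 B0.
have L0 : L setcomp0 = 1.
  have := LE setcomp0; rewrite big_nat1 [st_take _ _]T0 // [st_drop _ _]T0 //.
  by rewrite mulr1.
have P0 : P setcomp0 = 1.
  have := PE setcomp0; rewrite big_nat1 [st_take _ _]T0 // [st_drop _ _]T0 //.
  by rewrite mul1r.
pose F j k := L (st_take j A) * Mb (st_take (k - j) (st_drop j A))
                * P (st_drop k A).
have E1 : \sum_(0 <= k < (size A).+1) \sum_(0 <= j < k.+1) F j k = P A.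
  rewrite big_nat_recl // big_nat1 {1}/F subnn big_nat_cond big1 => [|k]; last first.
    rewrite andbT => /andP[_ kA].
    transitivity ((\sum_(0 <= j < k.+2) L (st_take j (st_take k.+1 A))
                  * Mb (st_drop j (st_take k.+1 A))) * P (st_drop k.+1 A)).
      rewrite mulr_suml; apply: eq_big_nat => j; rewrite ltnS => /andP[_ jk].
      have e1 := st_take_st_take A jk; have e2 := st_drop_st_take A jk.
      by rewrite /F -e1 -e2.
    have := LE (st_take k.+1 A); rewrite size_st_take // => ->.
    by rewrite mul0r.
  rewrite addr0 st_drop0.
  have e B : st_take 0 B = setcomp0 by apply: T0; rewrite size_st_take.
  by rewrite !e L0 !mul1r.
have E2 : \sum_(0 <= k < (size A).+1) \sum_(0 <= j < k.+1) F j k = L A.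
  rewrite triangle big_nat_recr //= big_nat_cond big1 ?add0r => [|j]; last first.
    rewrite andbT => /andP[_ jA].
    transitivity (L (st_take j A) * \sum_(0 <= i < (size (st_drop j A)).+1)
         Mb (st_take i (st_drop j A)) * P (st_drop i (st_drop j A))).
      rewrite -{1}[j]add0n big_addn size_st_drop subSn ?(ltnW jA) // mulr_sumr.
      apply: eq_big_nat => i _; rewrite /F addnK mulrA.
      exact: (congr1 (fun B => _ * _ * P B) (esym (st_drop_st_drop i j A))).
    by rewrite PE size_st_drop subn_eq0 leqNgt jA mulr0.
  rewrite big_nat1 /F subnn st_take_size.
  have dA : st_drop (size A) A = setcomp0 by apply: T0; rewrite size_st_drop subnn.
  by rewrite dA [st_take 0 _]T0 ?size_st_take // P0 !mulr1.
by rewrite -E1 E2.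
Qed.

Lemma antipode_exists : exists S : {linear NCQSym R -> NCQSym R}, is_antipode S.
Proof.
have SE A : fm_lin Lant (Mb A) = Lant A by exact: fm_lin_basis.
exists (fm_lin Lant : {linear NCQSym R -> NCQSym R}) => x.
pose e : {linear NCQSym R -> NCQSym R} :=
  fm_lin (fun A => counit (Mb A) *: (1 : NCQSym R)).
have eE y : e y = counit y *: (1 : NCQSym R).
  rewrite /counit [in RHS](fm_expand y) /fm_lin fm_coeff_sum scaler_suml.
  by apply: eq_bigr => A _; rewrite fm_coeffZ scalerA.
have eB A : e (Mb A) = (size A == 0)%N%:R.
  rewrite eE /counit fm_coeff_basis eq_sym setcomp_size0.
  by case: eqP; rewrite ?scale1r ?scale0r.
rewrite -eE; split; apply: (@NCQSym_lin_ext (convolution _ _) e) => A /=;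
  rewrite eB convolution_M_set.
- by rewrite -LantE; apply: eq_bigr => k _; rewrite SE.
by rewrite -RantE; apply: eq_bigr => k _; rewrite SE (convolution_inv_unique LantE RantE).
Qed.

Lemma antipode_unique (S T : {linear NCQSym R -> NCQSym R}) :
  is_antipode S -> is_antipode T -> S =1 T.
Proof.
have unitE A : counit (Mb A) *: (1 : NCQSym R) = (size A == 0)%N%:R.
  rewrite /counit fm_coeff_basis eq_sym setcomp_size0.
  by case: eqP; rewrite ?scale1r ?scale0r.
move=> SP TP; apply: NCQSym_lin_ext.
apply: (convolution_inv_unique (L := S \o Mb) (P := T \o Mb)) => A.
  by rewrite -unitE -(SP _).1 convolution_M_set.
by rewrite -unitE -(TP _).2 convolution_M_set.
Qed.
End Antipode.

Section Compositions.
Local Open Scope nat_scope.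
Variable n : nat.

Record composition := Composition {
  parts :> seq nat;
  compositionP : all (fun a => 0 < a) parts && (sumn parts == n)
}.

HB.instance Definition _ := [isSub for parts].
HB.instance Definition _ := [Choice of composition by <:].

Lemma leq_sumn a (s : seq nat) : a \in s -> a <= sumn s.
Proof.
elim: s => //= b s IH; rewrite inE => /predU1P[->|/IH]; first exact: leq_addr.
by move/leq_trans; apply; exact: leq_addl.
Qed.

Lemma size_composition (c : composition) : size c <= n.
Proof.
case: c => s /= /andP[s_gt0 /eqP <-].
elim: s s_gt0 => //= a s IH /andP[a0 /IH]; rewrite -add1n; exact: leq_add.
Qed.

Definition comp_code (c : composition) : n.-bseq 'I_n.+1 :=
  insub_bseq n [seq inord a | a <- c].
Definition comp_decode (b : n.-bseq 'I_n.+1) : option composition :=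
  insub [seq val i | i <- b].

Lemma comp_codeK : pcancel comp_code comp_decode.
Proof.
move=> c; rewrite /comp_decode /comp_code insubdK; last first.
  by rewrite unfold_in size_map size_composition.
suff -> : [seq val i | i <- [seq inord a | a <- c] : seq 'I_n.+1] = val c.
  exact: valK.
rewrite -map_comp; apply: map_id_in => a ac /=; rewrite inordK // ltnS.
have /andP[_ /eqP sum_c] := compositionP c.
by rewrite -[X in _ <= X]sum_c; apply: leq_sumn.
Qed.

HB.instance Definition _ : isCountable composition := PCanIsCountable comp_codeK.
HB.instance Definition _ : isFinite composition := PCanIsFinite comp_codeK.

End Compositions.

(* [beta] is the concatenation of lists with sums alpha_1, alpha_2, etc., the
   lengths of which are a composition [sh] of l(beta). *)
Definition refines n (beta alpha : composition n) : bool :=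
  [exists sh : composition (size beta), [seq sumn s | s <- reshape sh beta] == alpha].

Lemma refinesP n (beta alpha : composition n) :
  reflect (exists2 ss : seq (seq nat), flatten ss = beta & map sumn ss = alpha)
          (refines beta alpha).
Proof.
apply: (iffP existsP) => [[sh /eqP shP]|[ss ssb ssa]].
  exists (reshape sh beta) => //; apply: reshapeKr.
  by have /andP[_ /eqP ->] := compositionP sh.
have sh_proof : all (fun a => 0 < a)%N (shape ss) && (sumn (shape ss) == size beta).
  rewrite -size_flatten ssb eqxx andbT all_map; apply/allP=> s sss /=.
  have /andP[/allP/(_ (sumn s)) + _] := compositionP alpha.
  by rewrite -ssa map_f // => /(_ isT); case: s {sss}.
by exists (Composition sh_proof); rewrite /= -ssb flattenK ssa.
Qed.

Section Families.
Variables (n : nat).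
Implicit Types (alpha beta : composition n) (rho : 'S_n).

(* The permutation [rho] of 'I_n stands for k.+1 |-> (rho k).+1. *)
Definition A_comp_seq alpha rho : seq {fset nat} :=
  [seq [fset (rho k).+1 | k : 'I_n &
          (sumn (take j alpha) < k.+1 <= sumn (take j.+1 alpha))%N]%fset
     | j <- iota 0 (size alpha)].

Lemma leq_sumn_take (s : seq nat) i j :
  (i <= j)%N -> (sumn (take i s) <= sumn (take j s))%N.
Proof.
by move=> ij; rewrite -(subnKC ij) takeD sumn_cat leq_addr.
Qed.

Lemma A_comp_proof alpha rho : is_setcomp (A_comp_seq alpha rho).
Proof.
have /andP[/allP a_gt0 /eqP a_sum] := compositionP alpha.
apply: (@is_setcompP _ n); last first.
  apply/fsetP=> k; rewrite in_ground in_NN has_map; apply/hasP/idP.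
    by case=> j _ /= /imfsetP[i _ ->]; rewrite ltn_ord.
  case: k => // k /= kn; pose i := ((rho^-1)%g (Ordinal kn)).
  have ia : (i < sumn alpha)%N by rewrite a_sum.
  exists (reshape_index alpha i).
    by rewrite mem_iota /= reshape_indexP.
  apply/imfsetP; exists i; last by rewrite /i permKV.
  have := reshape_offsetP ia; rewrite /= inE.
  rewrite (take_nth 0) ?reshape_indexP // sumn_rcons => off.
  have iE := reshape_indexK alpha i; rewrite /flatten_index in iE.
  apply/andP; split; first by rewrite ltnS -[X in (_ <= X)%N]iE leq_addr.
  by rewrite -[X in (X < _)%N]iE ltn_add2l.
apply/andP; split.
  apply/allP=> B /mapP[j]; rewrite mem_iota add0n /= => ja ->.
  have jn : (sumn (take j alpha) < n)%N.
    rewrite -[X in (_ < X)%N]a_sum -[X in (_ < sumn X)%N](cat_take_drop j alpha).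
    rewrite sumn_cat -[X in (X < _)%N]addn0 ltn_add2l (drop_nth 0) //=.
    by rewrite ltn_addr // a_gt0 // mem_nth.
  apply/fset0Pn; exists (rho (Ordinal jn)).+1; apply/imfsetP.
  exists (Ordinal jn) => //=; rewrite inE /= leqnn /=.
  rewrite (take_nth 0) // sumn_rcons -addn1 leq_add2l.
  by rewrite a_gt0 // mem_nth.
rewrite pairwise_map.
have : sorted ltn (iota 0 (size alpha)) by exact: iota_ltn_sorted.
rewrite (sorted_pairwise ltn_trans); apply: sub_pairwise => i j ij /=.
apply/fdisjointP => x /imfsetP[k /=]; rewrite inE => /andP[_ ki] ->.
apply/negP => /imfsetP[l /=]; rewrite inE => /andP[jl _] [].
move=> /val_inj /perm_inj kl; move: ki; rewrite kl leqNgt.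
by rewrite (leq_ltn_trans _ jl) // leq_sumn_take.
Qed.

Definition A_comp alpha rho : setcomp := SetComp (A_comp_proof alpha rho).

Variable R : comPzRingType.

Definition M_comp alpha rho : NCQSym R := M_set R (A_comp alpha rho).

Definition F_comp alpha rho : NCQSym R :=
  \sum_(beta | refines beta alpha) M_comp beta rho.

Definition E_comp alpha rho : NCQSym R :=
  \sum_(beta | refines alpha beta) M_comp beta rho.

Lemma comp_row_proof (n_gt0 : (0 < n)%N) :
  all (fun a => 0 < a)%N [:: n] && (sumn [:: n] == n).
Proof. by rewrite /= n_gt0 addn0 eqxx. Qed.

Lemma comp_col_proof : all (fun a => 0 < a)%N (nseq n 1%N) && (sumn (nseq n 1%N) == n).
Proof. by rewrite sumn_nseq mul1n eqxx andbT all_nseq orbT. Qed.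

Definition comp_row (n_gt0 : (0 < n)%N) : composition n :=
  Composition (comp_row_proof n_gt0).

Definition comp_col : composition n := Composition comp_col_proof.

Definition w0 : 'S_n := perm (@rev_ord_inj n).

End Families.

Arguments M_comp {n R} alpha rho.
Arguments F_comp {n R} alpha rho.
Arguments E_comp {n R} alpha rho.

(* Main.v *)
(** The words of M_beta^{w0} are weakly decreasing, and F_n^{w0} is the sum of
    all weakly decreasing words of length n; likewise M_{1^n}^{w0}, F_n^{Id} and
    M_{1^n}^{Id} are the sums of all strictly decreasing, weakly
    increasing and strictly increasing words.  Let D_n be the sum of the weakly
    (strictly) decreasing words of length n and U_n the sum of the strictly
    (weakly) increasing ones.  Deconcatenation gives
    Delta D_n = sum_i D_i (x) D_{n-i}, so S(D_n) is determined recursively by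
    sum_i S(D_i) D_{n-i} = 0 for n > 0.  The family (-1)^n U_n satisfies the
    same recursion: the coefficient of w in sum_i (-1)^i U_i D_{n-i} counts with
    signs the cuts of w into an increasing and a decreasing part, and these cuts
    come in pairs of opposite signs. *)

Require Import Defs.
From mathcomp Require Import all_boot all_order all_algebra all_fingroup.
From mathcomp Require Import finmap monalg zify.
Import GRing.Theory.
Local Open Scope ring_scope.
Set Implicit Arguments.
Unset Strict Implicit.
Unset Printing Implicit Defensive.

(** * Weakly increasing words and their run lengths *)

Section Words.
Local Open Scope nat_scope.
Implicit Types s I w : seq nat.

(** Run-length decoding. For positive [s] and increasing [I] of the same length it is the word of
    x_I^A with A = A_s^Id, and [mults] and [letters] recover [s] and [I]. *)
Definition expand s I : seq nat := flatten [seq nseq p.1 p.2 | p <- zip s I].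

Lemma shape_expand s I :
  size I = size s -> shape [seq nseq p.1 p.2 | p <- zip s I] = s.
Proof.
move=> sz; rewrite /shape -map_comp -[RHS](@unzip1_zip _ _ s I) ?sz //.
by apply: eq_map => p /=; rewrite size_nseq.
Qed.

Lemma size_expand s I : size I = size s -> size (expand s I) = sumn s.
Proof. by move=> sz; rewrite size_flatten shape_expand. Qed.

Lemma nth_expand s I k :
  size I = size s -> k < sumn s -> nth 0 (expand s I) k = nth 0 I (reshape_index s k).
Proof.
move=> sz ks; have js := reshape_indexP ks.
rewrite nth_flatten shape_expand // (nth_map (0, 0)) ?size_zip ?sz ?minnn //.
by rewrite nth_zip //= nth_nseq reshape_offsetP.
Qed.

Lemma count_expand s I i :
  size I = size s -> uniq I -> count_mem i (expand s I) = nth 0 s (index i I).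
Proof.
move=> /esym; rewrite /expand.
elim: s I => [|a s IH] [|x I] //= [sz] /andP[xI uI].
rewrite count_cat count_nseq /= IH //; case: eqP => [<-|_] /=.
  by rewrite mul1n nth_default ?addn0 // sz leqNgt index_mem.
by rewrite mul0n.
Qed.

Lemma mem_expand s I i :
  all (ltn 0) s -> size I = size s -> uniq I -> (i \in expand s I) = (i \in I).
Proof.
move=> /(all_nthP 0) s0 sz uI.
rewrite -has_pred1 has_count count_expand // -index_mem sz.
by case: (ltnP (index i I)) => [/s0/= |/(nth_default 0) ->].
Qed.

Lemma expand_sorted s I : sorted ltn I -> sorted leq (expand s I).
Proof.
rewrite /expand (sorted_pairwise ltn_trans) (sorted_pairwise leq_trans).
elim: I s => [|x I IH] [|a s] //= /andP[/allP xI sI].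
rewrite pairwise_cat IH // andbT; apply/andP; split; last first.
  by elim: a => //= a ->; rewrite all_nseq leqnn orbT.
apply/allrelP => y z; rewrite mem_nseq => /andP[_ /eqP ->].
elim: s I xI {IH sI} => [|b s IH] [|u I] //= xI; rewrite mem_cat => /orP[].
  by rewrite mem_nseq => /andP[_ /eqP ->]; rewrite ltnW // xI ?mem_head.
by apply: IH => v vI; apply: xI; rewrite inE vI orbT.
Qed.

Definition mults w : seq nat := [seq count_mem i w | i <- letters w].

Lemma letters_uniq w : uniq (letters w).
Proof. exact: (sorted_uniq ltn_trans ltnn (letters_sorted w)). Qed.

Lemma expand_letters s I :
  all (ltn 0) s -> size I = size s -> sorted ltn I -> letters (expand s I) = I.
Proof.
move=> s0 sz sI; apply: letters_eq => // i; rewrite mem_expand //.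
exact: (sorted_uniq ltn_trans ltnn sI).
Qed.

Lemma expand_mults s I :
  all (ltn 0) s -> size I = size s -> sorted ltn I -> mults (expand s I) = s.
Proof.
move=> s0 sz sI; rewrite /mults expand_letters //.
have uI := sorted_uniq ltn_trans ltnn sI.
apply: (@eq_from_nth _ 0) => [|j]; rewrite size_map // => jI.
by rewrite (nth_map 0) // count_expand // index_uniq.
Qed.

(** A sorted word is determined by the number of occurrences of each letter. *)
Lemma mults_expand w : sorted leq w -> expand (mults w) (letters w) = w.
Proof.
move=> sw; apply: (sorted_eq leq_trans anti_leq) => //.
  exact/expand_sorted/letters_sorted.
apply/allP => i _ /=; rewrite count_expand ?size_map ?letters_uniq //.
have [iw|iw] := boolP (i \in w).
  by rewrite (nth_map 0) ?index_mem ?nth_index ?mem_letters.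
rewrite nth_default ?size_map; first by rewrite (count_memPn iw).
by rewrite leqNgt index_mem mem_letters.
Qed.

Lemma mults_gt0 w : all (ltn 0) (mults w).
Proof.
by apply/allP => _ /mapP[i +] ->; rewrite mem_letters -has_pred1 has_count.
Qed.

Lemma sumn_mults w : sorted leq w -> sumn (mults w) = size w.
Proof. by move=> /mults_expand {2}<-; rewrite size_expand ?size_map. Qed.

Lemma mults_nseq1 n w : size w = n -> (nseq n 1 == mults w) = uniq w.
Proof.
move=> sw; apply/eqP/idP => [/(congr1 size)|uw].
  rewrite size_nseq size_map size_sort => sz.
  by apply/negPn; rewrite -ltn_size_undup -sz sw ltnn.
suff /all_pred1P : all (pred1 1) (mults w).
  by rewrite size_map size_sort undup_id // sw => ->.
apply/allP => _ /mapP[i + ->] /=.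
by rewrite mem_letters count_uniq_mem // => ->.
Qed.

End Words.

(** * Signed counting of the cuts of a word *)

Section Alternation.
Variables (R : pzRingType) (T : Type) (r : rel T).
Let nr : rel T := fun x y => ~~ r x y.

(* The terms cancel in pairs: a cut before or after the position i, according
   to whether r holds between the letters at i and i + 1. *)
Lemma alternating_cuts (w : seq T) :
  \sum_(i < (size w).+1)
     (-1) ^+ i * ((sorted r (take i w))%:R * (sorted nr (drop i w))%:R)
    = (size w == 0)%N%:R :> R.
Proof.
case: w => [|x w]; first by rewrite big_ord1 !mul1r.
rewrite big_ord_recl /= !mul1r.
(* The sum over the later cuts, with one sign factored out, must equal the contribution
   [path nr x w] of the cut before [x]. *)
suff: \sum_(i < (size w).+1)
    (-1) ^+ i * ((path r x (take i w))%:R * (sorted nr (drop i w))%:R)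
    = (path nr x w)%:R :> R.
  move=> <-; rewrite -big_split big1 // => i _ /=.
  by rewrite add0n exprS mulN1r mulNr subrr.
elim: w x => [|y w IH] x; first by rewrite big_ord1 !mul1r.
rewrite big_ord_recl /= !mul1r.
(* Here [x] and [y] both lie left of the cut, so [r x y] factors out and the induction hypothesis
   for [y] applies. *)
have -> : \sum_(i < (size w).+1) (-1) ^+ bump 0 i *
      ((r x y && path r y (take i w))%:R * (sorted nr (drop i w))%:R)
    = - ((r x y)%:R * (path nr y w)%:R) :> R.
  rewrite -IH mulr_sumr -sumrN; apply: eq_bigr => i _.
  rewrite exprS mulN1r mulNr; congr (- _).
  by case: (r x y); rewrite /= ?mul1r // !mul0r mulr0.
rewrite (_ : nr x y = ~~ r x y) //; case: (r x y) => /=; first by rewrite mul1r subrr.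
by rewrite mul0r subr0.
Qed.
End Alternation.

(** * Coefficients of words in M_beta^rho *)

Section Coefficients.
Local Open Scope nat_scope.
Variable n : nat.
Implicit Types (beta : composition n) (rho : 'S_n).

(** Reading the positions in the order rho(1), ..., rho(n) makes every word of M_beta^rho weakly
    increasing, with run lengths beta. *)
Definition permute_word rho (w : seq nat) : seq nat :=
  [seq nth 0 w (rho k) | k <- enum 'I_n].

Lemma size_permute_word rho w : size (permute_word rho w) = n.
Proof. by rewrite size_map size_enum_ord. Qed.

Lemma nth_permute_word rho w (k : 'I_n) : nth 0 (permute_word rho w) k = nth 0 w (rho k).
Proof.
by rewrite (nth_map k) ?size_enum_ord // nth_ord_enum.
Qed.

Lemma sumn_composition beta : sumn beta = n.
Proof. by have /andP[_ /eqP] := compositionP beta. Qed.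

Lemma composition_gt0 beta : all (ltn 0) beta.
Proof. by have /andP[] := compositionP beta. Qed.

Lemma size_A_comp beta rho : size (A_comp beta rho) = size beta.
Proof. by rewrite /= size_map size_iota. Qed.

Lemma mem_A_comp beta rho (k : 'I_n) :
  (rho k).+1 \in nth fset0 (A_comp beta rho) (reshape_index beta k).
Proof.
have kb : k < sumn beta by rewrite sumn_composition.
have jb := reshape_indexP kb; have := reshape_offsetP kb.
have kE := reshape_indexK beta k; rewrite /flatten_index in kE.
rewrite (nth_map 0) ?size_iota // nth_iota // add0n => off.
apply/imfsetP; exists k => //=; rewrite inE (take_nth 0) // sumn_rcons.
rewrite -{2 3}kE; lia.
Qed.

Lemma sdegree_A_comp beta rho : sdegree (A_comp beta rho) = n.
Proof.
rewrite -[RHS]card_NN /sdegree; congr #|` _|%fset.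
apply/fsetP=> x; rewrite in_ground in_NN; apply/hasP/idP.
  by case=> _ /mapP[j _ ->] /imfsetP[i _ ->]; rewrite ltn_ord.
case: x => // x /= xn; pose k := ((rho^-1)%g (Ordinal xn)).
exists (nth fset0 (A_comp beta rho) (reshape_index beta k)).
  by rewrite mem_nth // size_A_comp reshape_indexP // sumn_composition.
by have := mem_A_comp beta rho k; rewrite permKV.
Qed.

Lemma permute_xword beta rho I : size I = size beta ->
  permute_word rho (xword (A_comp beta rho) I) = expand beta I.
Proof.
move=> sz; apply: (@eq_from_nth _ 0).
  by rewrite size_permute_word size_expand // sumn_composition.
rewrite size_permute_word => k kn; rewrite -[k]/(val (Ordinal kn)).
set i := Ordinal kn.
have ib : i < sumn beta by rewrite sumn_composition.
rewrite nth_permute_word nth_xword ?sdegree_A_comp // nth_expand //.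
congr (nth 0 I _); apply: bindex_nth (mem_A_comp _ _ _).
  exact: setcomp_osp.
by rewrite size_A_comp reshape_indexP.
Qed.

Lemma permute_word_inj rho w w' : size w = n -> size w' = n ->
  permute_word rho w = permute_word rho w' -> w = w'.
Proof.
move=> sw sw' e; apply: (@eq_from_nth _ 0); rewrite sw // => k kn.
have := congr1 (nth 0 ^~ ((rho^-1)%g (Ordinal kn))) e.
by rewrite !nth_permute_word permKV.
Qed.

(** By [in_ME] this tells when [w] occurs in M_beta^rho; the set I is then formed by the letters of
    [w]. *)
Lemma A_comp_eq_pack beta rho w :
  (A_comp beta rho == pack w) =
  [&& size w == n, sorted leq (permute_word rho w)
    & parts beta == mults (permute_word rho w)].
Proof.
have b0 := composition_gt0 beta.
rewrite -in_ME; apply/in_MP/and3P => [[I [sI + ->]]|[/eqP szw sw /eqP bE]].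
  rewrite size_A_comp => szI; rewrite size_xword sdegree_A_comp permute_xword //.
  by rewrite expand_mults // expand_sorted.
exists (letters (permute_word rho w)).
have sz : size (letters (permute_word rho w)) = size beta by rewrite bE size_map.
split; [exact: letters_sorted | by rewrite size_A_comp |].
apply: (@permute_word_inj rho); rewrite ?size_xword ?sdegree_A_comp //.
by rewrite permute_xword // bE mults_expand.
Qed.

Variable R : comPzRingType.

Lemma coeff_M_comp beta rho w :
  (M_comp beta rho : NCQSym R)@_(pack w) = (A_comp beta rho == pack w)%:R%R.
Proof. exact: fm_coeff_basis. Qed.

(** A word of length n that [permute_word rho] sorts occurs in exactly one M_beta^rho, where beta
    lists its run lengths. *)
Lemma coeff_sum_M_comp rho w :
  (\sum_beta M_comp beta rho : NCQSym R)%R@_(pack w)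
    = ((size w == n) && sorted leq (permute_word rho w))%:R%R.
Proof.
rewrite fm_coeff_sum; under eq_bigr do rewrite coeff_M_comp A_comp_eq_pack.
case: eqP => [szw|_] /=; last by rewrite big1.
case: (boolP (sorted leq _)) => [sw|_] /=; last by rewrite big1.
have mP : all (fun a => 0 < a) (mults (permute_word rho w))
          && (sumn (mults (permute_word rho w)) == n).
  by rewrite mults_gt0 sumn_mults // size_permute_word eqxx.
rewrite (bigD1 (Composition mP)) //= eqxx big1 ?addr0 // => beta.
by rewrite -val_eqE /= => /negbTE ->.
Qed.

Lemma coeff_M_comp_col rho w :
  (M_comp (comp_col n) rho : NCQSym R)@_(pack w)
    = ((size w == n) && sorted ltn (permute_word rho w))%:R%R.
Proof.
rewrite coeff_M_comp A_comp_eq_pack; congr ((_ && _)%:R%R).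
by rewrite ltn_sorted_uniq_leq andbC mults_nseq1 // size_permute_word.
Qed.

Lemma permute_word1 w : size w = n -> permute_word 1%g w = w.
Proof.
move=> sw; apply: (@eq_from_nth _ 0); rewrite size_permute_word ?sw // => k kn.
by rewrite -[k]/(val (Ordinal kn)) nth_permute_word perm1.
Qed.

Lemma permute_word_w0 w : size w = n -> permute_word (w0 n) w = rev w.
Proof.
move=> sw; apply: (@eq_from_nth _ 0); rewrite size_permute_word ?size_rev ?sw // => k kn.
by rewrite -[k]/(val (Ordinal kn)) nth_permute_word permE nth_rev sw.
Qed.

End Coefficients.

(** * Deconcatenation of the set compositions A_beta^{w0} *)

Section Coproduct.
Local Open Scope nat_scope.

(* The blocks of A_s^{w0}: the j-th one is the interval from
   s_{j+1} + ... + s_l + 1 to s_j + ... + s_l. *)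
Fixpoint dec (s : seq nat) : seq {fset nat} :=
  if s is a :: s' then [fset x in iota (sumn s').+1 a]%fset :: dec s' else [::].

Lemma size_dec s : size (dec s) = size s.
Proof. by elim: s => //= a s ->. Qed.

Lemma mem_nth_dec s j x :
  (x \in nth fset0 (dec s) j) = (sumn (drop j.+1 s) < x <= sumn (drop j s)).
Proof.
elim: s j => [|a s IH] [|j] /=; rewrite ?nth_nil ?in_fset0 ?IH //; try lia.
rewrite drop0 !inE mem_iota; lia.
Qed.

Lemma A_comp_w0 n (beta : composition n) : A_comp beta (w0 n) = dec beta :> seq _.
Proof.
apply: (@eq_from_nth _ fset0); first by rewrite size_A_comp size_dec.
move=> j; rewrite size_A_comp => jb; apply/fsetP => x.
rewrite mem_nth_dec (nth_map 0) ?size_iota // nth_iota // add0n.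
have sum_td i : sumn (take i beta) + sumn (drop i beta) = n.
  by rewrite -sumn_cat cat_take_drop sumn_composition.
have := sum_td j; have := sum_td j.+1 => e1 e2.
apply/imfsetP/idP => [[k /=]|xb].
  by rewrite inE => /= kb ->; rewrite permE /=; have := ltn_ord k; lia.
have kn : n - x < n by lia.
exists (Ordinal kn); first by rewrite inE /=; lia.
by rewrite permE /=; lia.
Qed.

Lemma dec_setcomp s : all (ltn 0) s -> is_setcomp (dec s).
Proof.
move=> s0; have sP : all (fun a => 0 < a) s && (sumn s == sumn s) by rewrite s0 eqxx.
by rewrite -(A_comp_w0 (Composition sP)) setcompP.
Qed.

(** The remaining parts occupy the smallest numbers, so the first [k] blocks are shifted up by their
    sum; [st] undoes this shift. *)
Lemma take_dec k s :
  take k (dec s) = relabel (addn (sumn (drop k s))) (dec (take k s)).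
Proof.
elim: s k => [|a s IH] [|k] //=; rewrite IH; congr cons.
have e : sumn (take k s) + sumn (drop k s) = sumn s by rewrite -sumn_cat cat_take_drop.
apply/fsetP => x; rewrite inE /= mem_iota; apply/idP/imfsetP => [xa|[y /=]].
  exists (x - sumn (drop k s)); last by lia.
  by rewrite /= inE mem_iota; lia.
by rewrite inE mem_iota => /= ya ->; lia.
Qed.

Lemma drop_dec k s : drop k (dec s) = dec (drop k s).
Proof. by elim: s k => [|a s IH] [|k] /=. Qed.

(** Indexed by plain lists, so that [take] and [drop] cause no change of type; the default
    [setcomp0] is reached only if some part is zero. *)
Definition dec_sc s : setcomp := insubd setcomp0 (dec s).

Lemma dec_scE s : all (ltn 0) s -> dec_sc s = dec s :> seq _.
Proof. by move=> s0; rewrite val_insubd dec_setcomp. Qed.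

Lemma st_dec s : all (ltn 0) s -> st (dec s) = dec s.
Proof. by move=> s0; rewrite -dec_scE // st_setcompK. Qed.

Lemma A_comp_dec_sc n (beta : composition n) : A_comp beta (w0 n) = dec_sc beta.
Proof.
by apply: val_inj; rewrite [LHS]A_comp_w0 [RHS]dec_scE ?composition_gt0.
Qed.

Lemma st_take_dec k s : all (ltn 0) s -> st_take k (dec_sc s) = dec_sc (take k s).
Proof.
move=> s0; have t0 : all (ltn 0) (take k s) by apply/allP => x /mem_take /(allP s0).
apply: val_inj; rewrite /= dec_scE // [RHS]dec_scE // take_dec st_relabel ?st_dec //.
by move=> x y _ _; rewrite leq_add2l.
Qed.

Lemma st_drop_dec k s : all (ltn 0) s -> st_drop k (dec_sc s) = dec_sc (drop k s).
Proof.
move=> s0; have d0 : all (ltn 0) (drop k s) by apply/allP => x /mem_drop /(allP s0).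
by apply: val_inj; rewrite /= dec_scE // [RHS]dec_scE // drop_dec st_dec.
Qed.

Definition compositions n : seq (seq nat) := [seq parts beta | beta : composition n].

Lemma compositions_uniq n : uniq (compositions n).
Proof. by rewrite map_inj_uniq ?enum_uniq //; exact: val_inj. Qed.

Lemma mem_compositions n s : (s \in compositions n) = all (ltn 0) s && (sumn s == n).
Proof.
apply/imageP/idP => [[beta _ ->]|sP]; first exact: compositionP.
by exists (Composition sP).
Qed.

(** The coproduct formula for D_n on index sets: concatenation inverts a cut, and [i] is the sum of
    the left piece. *)
Lemma cut_compositions n :
  perm_eq [seq (take k s, drop k s) | s <- compositions n, k <- index_iota 0 (size s).+1]
    [seq p | i <- index_iota 0 n.+1,
             p <- [seq (s, t) | s <- compositions i, t <- compositions (n - i)]].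
Proof.
apply: uniq_perm => [||[s t]].
- apply: allpairs_uniq_dep => [|s _|]; rewrite ?compositions_uniq ?iota_uniq //.
  move=> _ _ /allpairsPdep[s [k [_ ks ->]]] /allpairsPdep[t [l [_ lt ->]]] /= [et ed].
  (* The two pieces determine [s], and the length of the left one determines [k] because
     [k <= size s]. *)
  have st : s = t by rewrite -(cat_take_drop k s) et ed cat_take_drop.
  move: ks lt; rewrite st !mem_index_iota /= !ltnS => kt lt.
  by have := congr1 size et; rewrite st !size_takel // => ->.
- apply: allpairs_uniq_dep => [|i _|]; rewrite ?iota_uniq //.
    apply: allpairs_uniq => [||[? ?] [? ?] _ _ /= [-> ->]] //; exact: compositions_uniq.
  move=> _ _ /allpairsPdep[i [p [_ ip ->]]] /allpairsPdep[j [q [_ jq ->]]] /= pq.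
  subst q; move: ip jq => /allpairsP[p1 [+ _ ->]] /allpairsP[p2 [+ _ []]].
  by rewrite !mem_compositions => /andP[_ /eqP <-] /andP[_ /eqP <-] ->.
apply/allpairsPdep/allpairsPdep => [[u [k [un ku [-> ->]]]]|[i [p [ii ip pE]]]].
  move: un; rewrite mem_compositions -{1 2}(cat_take_drop k u) all_cat sumn_cat.
  case/andP=> /andP[u1 u2] /eqP un.
  exists (sumn (take k u)), (take k u, drop k u); split=> //.
    by rewrite mem_index_iota; lia.
  by apply/allpairsP; exists (take k u, drop k u); rewrite !mem_compositions u1 u2 -un addKn !eqxx.
move: ip; rewrite -pE => /allpairsP[[s' t'] /= [+ + [-> ->]]].
rewrite !mem_compositions => /andP[s0 /eqP si] /andP[t0 /eqP ti].
move: ii; rewrite mem_index_iota => ii.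
exists (s' ++ t'), (size s'); split.
- by rewrite mem_compositions all_cat s0 t0 sumn_cat si ti; apply/eqP; lia.
- by rewrite mem_index_iota size_cat ltnS /= leq_addr.
by rewrite take_size_cat ?drop_size_cat.
Qed.

End Coproduct.

(** * The recursion for the antipode, for an arbitrary relation [r] *)

Section AntipodeOfChains.
Variables (R : comPzRingType) (S : {linear NCQSym R -> NCQSym R}).
Hypothesis antipodeS : is_antipode S.

Lemma coeff_natb (b : bool) w :
  (b%:R : NCQSym R)@_(pack w) = (b && (w == [::]))%:R.
Proof.
by case: b; rewrite ?mcoeff0 // [LHS]fm_coeff_basis pack_eq0.
Qed.

Variables (r : rel nat) (D U : nat -> NCQSym R).
Hypothesis coeffU : forall i w,
  (U i)@_(pack w) = ((size w == i) && sorted r w)%:R.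
Hypothesis coeffD : forall i w,
  (D i)@_(pack w) = ((size w == i) && sorted (fun x y => ~~ r x y) w)%:R.

(** At [w], the product of U_i and D_{n-i} only sees the cut after i letters, and only if [w] has
    length n; what remains is [alternating_cuts]. *)
Lemma alternating_sum_chains n :
  \sum_(i < n.+1) (-1) ^+ i *: (U i * D (n - i)%N) = (n == 0)%N%:R.
Proof.
apply: NCQSymP => w; rewrite fm_coeff_sum coeff_natb.
under eq_bigr => i _ do
  (rewrite fm_coeffZ ncmulE; under eq_bigr => j _ do rewrite coeffU coeffD).
have [<-{n}|szw] := eqVneq (size w) n; last first.
  rewrite big1 => [|i _].
    by case: w szw => [|x w] //=; rewrite ?andbF // eq_sym => /negbTE ->.
  rewrite big1 ?mulr0 // => j _.
  rewrite size_drop size_takel -1?ltnS //.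
  have [ji|] := eqVneq (val j) i; last by rewrite mul0r.
  case: eqP => [wj|]; last by rewrite mulr0.
  case/eqP: szw; have := ltn_ord j; have := ltn_ord i; move: ji wj => /=; lia.
transitivity ((size w == 0)%N%:R : R); last by case: (w).
rewrite -(alternating_cuts R r w); apply: eq_bigr => i _; congr (_ * _).
rewrite (bigD1 i) //= size_drop size_takel -1?ltnS // !eqxx big1 ?addr0 // => j ji.
rewrite size_takel -1?ltnS //.
by rewrite val_eqE (negbTE ji) mul0r.
Qed.

(** (-1)^n U_n satisfies the recursion for S(D_n), in which S(D_n) is multiplied by D_0 = 1. *)
Lemma antipode_chains :
  (forall n, convolution S idfun (D n) = \sum_(i < n.+1) S (D i) * D (n - i)%N) ->
  forall n, S (D n) = (-1) ^+ n *: U n.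
Proof.
move=> comulD; have D0 : D 0 = 1.
  by apply: NCQSymP => w; rewrite coeffD (coeff_natb true) size_eq0; case: w.
move=> n; have [m] := ubnP n; elim: m n => // m IH n nm.
have := (antipodeS (D n)).1; rewrite comulD.
have -> : counit (D n) *: (1 : NCQSym R) = (n == 0)%N%:R.
  have -> : counit (D n) = (n == 0)%N%:R.
    rewrite /counit (_ : setcomp0 = pack [::]); last by apply/eqP; rewrite pack_eq0.
    by rewrite coeffD andbT eq_sym.
  by case: eqP; rewrite ?scale1r ?scale0r.
(* The terms with i < n agree by induction, hence so do the last terms S(D_n) and (-1)^n U_n. *)
rewrite -alternating_sum_chains !big_ord_recr /= subnn D0 !mulr1.
rewrite (eq_bigr (fun i : 'I_n => (-1) ^+ i *: (U i * D (n - i)%N))) => [|i _].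
  exact: addrI.
by rewrite IH ?NCQSym_scalerAl // (leq_trans (ltn_ord i)).
Qed.

End AntipodeOfChains.

(** * The sums for w0, and the extreme compositions (n) and 1^n *)

Section Families.
Variable R : comPzRingType.

Lemma convolution_dec_sc (f : {linear NCQSym R -> NCQSym R}) s : all (ltn 0%N) s ->
  convolution f idfun (M_set R (dec_sc s)) =
    \sum_(0 <= k < (size s).+1)
       f (M_set R (dec_sc (take k s))) * M_set R (dec_sc (drop k s)).
Proof.
move=> s0; rewrite convolution_M_set dec_scE // size_dec.
by apply: eq_bigr => k _; rewrite st_take_dec // st_drop_dec.
Qed.

(** The double sum over compositions of n and their cuts is reindexed by [cut_compositions]. *)
Lemma convolution_sum_M_w0 (f : {linear NCQSym R -> NCQSym R}) n :
  let D n := \sum_(beta : composition n) M_comp beta (w0 n) in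
  convolution f idfun (D n) = \sum_(i < n.+1) f (D i) * D (n - i)%N.
Proof.
move=> D; have DE m : D m = \sum_(s <- compositions m) M_set R (dec_sc s).
  by rewrite big_image; apply: eq_bigr => beta _; rewrite /M_comp A_comp_dec_sc.
rewrite DE linear_sum.
pose G p : NCQSym R := f (M_set R (dec_sc p.1)) * M_set R (dec_sc p.2).
transitivity (\sum_(p <- [seq (take k s, drop k s) |
    s <- compositions n, k <- index_iota 0 (size s).+1]) G p).
  rewrite big_allpairs_dep big_seq [RHS]big_seq; apply: eq_bigr => s.
  by rewrite mem_compositions => /andP[s0 _]; exact: convolution_dec_sc.
rewrite (perm_big _ (cut_compositions n)) big_allpairs_dep big_mkord.
apply: eq_bigr => i _; rewrite big_allpairs_dep !DE linear_sum mulr_suml.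
by apply: eq_bigr => s _; rewrite mulr_sumr.
Qed.

(** Cutting 1^n after i parts gives 1^i and 1^{n-i}, so the cuts are already the terms of the
    sum. *)
Lemma convolution_M_col_w0 (f : {linear NCQSym R -> NCQSym R}) n :
  let D n := M_comp (comp_col n) (w0 n) in
  convolution f idfun (D n) = \sum_(i < n.+1) f (D i) * D (n - i)%N.
Proof.
move=> D; have DE m : D m = M_set R (dec_sc (nseq m 1%N)).
  by rewrite /D /M_comp A_comp_dec_sc.
rewrite DE convolution_dec_sc ?all_nseq ?orbT // size_nseq big_mkord.
by apply: eq_bigr => i _; rewrite !DE take_nseq -1?ltnS // drop_nseq.
Qed.

(** Every composition refines (n): all its parts form a single group. *)
Lemma F_comp_row n (n_gt0 : (0 < n)%N) (rho : 'S_n) :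
  F_comp (comp_row n_gt0) rho = \sum_beta M_comp beta rho :> NCQSym R.
Proof.
apply: eq_bigl => beta; apply/refinesP; exists [:: parts beta].
  by rewrite /= cats0.
by rewrite /= sumn_composition.
Qed.

(** Splitting each part into ones shows that 1^n refines every composition; hence E_{1^n} is the
    same sum as F_n. *)
Lemma E_comp_col n (rho : 'S_n) :
  E_comp (comp_col n) rho = \sum_beta M_comp beta rho :> NCQSym R.
Proof.
apply: eq_bigl => beta; apply/refinesP; exists [seq nseq a 1%N | a <- beta].
  rewrite /= -[in RHS](sumn_composition beta).
  by elim: (parts beta) => //= a s ->; rewrite nseqD.
rewrite -map_comp -[RHS]map_id; apply: eq_map => a /=.
by rewrite sumn_nseq mul1n.
Qed.

(** A part of a refinement of 1^n is at most the sum of its group, which is 1. *)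
Lemma F_comp_col n (rho : 'S_n) :
  F_comp (comp_col n) rho = M_comp (comp_col n) rho :> NCQSym R.
Proof.
rewrite /F_comp (big_pred1 (comp_col n)) // => beta; apply/refinesP/eqP => [[ss]|->].
  move=> ssb ss1; apply: val_inj => /=.
  have /all_pred1P b1 : all (pred1 1%N) beta.
    apply/allP => a; have /allP/(_ a) := composition_gt0 beta.
    rewrite -ssb => a0 ass; move: (a0 ass) => /= {}a0.
    case/flattenP: ass => t tss /leq_sumn at_.
    have : sumn t \in parts (comp_col n) by rewrite -ss1 map_f.
    by rewrite /= mem_nseq => /andP[_ /eqP t1]; apply/eqP; lia.
  have := sumn_composition beta; rewrite b1 sumn_nseq mul1n => bn.
  by rewrite bn.
exists [seq [:: a] | a <- nseq n 1%N]; first by rewrite flatten_seq1.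
by rewrite -map_comp -[RHS]map_id; apply: eq_map => a /=; rewrite addn0.
Qed.

End Families.

Theorem theorem4p38 (R : comPzRingType) (S : {linear NCQSym R -> NCQSym R})
    (hS : is_antipode S) (n : nat) (hn : (2 <= n)%N) :
  S (F_comp (comp_row (ltnW hn)) (w0 n))
    = (-1) ^+ n *: F_comp (comp_col n) (1%g : 'S_n)
  /\ [/\ S (F_comp (comp_col n) (w0 n)) = S (M_comp (comp_col n) (w0 n)),
         S (M_comp (comp_col n) (w0 n))
           = (-1) ^+ n *: F_comp (comp_row (ltnW hn)) (1%g : 'S_n)
       & ((-1) ^+ n *: F_comp (comp_row (ltnW hn)) (1%g : 'S_n) : NCQSym R)
           = (-1) ^+ n *: E_comp (comp_col n) (1%g : 'S_n)].
Proof.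
(* The first and last equalities of the second conjunct become reflexivity. *)
rewrite !F_comp_row !F_comp_col E_comp_col; split; last split=> //.
(* The negation of [<] is [>=]: U consists of strictly increasing words and D of weakly decreasing
   ones, since w0 reverses words. *)
- apply: (antipode_chains hS (r := ltn)
    (D := fun m => \sum_(beta : composition m) M_comp beta (w0 m))
    (U := fun m => M_comp (comp_col m) 1%g)) => [i w|i w|m].
  + rewrite coeff_M_comp_col; congr ((nat_of_bool _)%:R).
    by case: eqP => // sw; rewrite permute_word1.
  + rewrite coeff_sum_M_comp; case: eqP => // sw.
    rewrite permute_word_w0 // rev_sorted /=; congr ((nat_of_bool _)%:R).
    by apply: eq_sorted => x y; rewrite /= -leqNgt.
  exact: convolution_sum_M_w0.
(* With [leq] instead, U is weakly increasing and D strictly decreasing. *)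
apply: (antipode_chains hS (r := leq)
    (D := fun m => M_comp (comp_col m) (w0 m))
    (U := fun m => \sum_(beta : composition m) M_comp beta 1%g)) => [i w|i w|m].
- by rewrite coeff_sum_M_comp; case: eqP => // sw; rewrite permute_word1.
- rewrite coeff_M_comp_col; case: eqP => // sw.
  rewrite permute_word_w0 // rev_sorted /=; congr ((nat_of_bool _)%:R).
  by apply: eq_sorted => x y; rewrite /= -ltnNge.
exact: convolution_M_col_w0.
Qed.
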